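(* Let $\kappa:\mathcal C\to\mathbb R$ be a continuous functional of degree at most two, with canonical polarization $b_\kappa$. Then $\kappa$ is a measure of concordance if and only if the following conditions hold. (B1) $b_\kappa(C^\gamma,D^\gamma)=\varepsilon(\gamma)\,b_\kappa(C,D)$ for all $C,D\in\mathcal C$ and $\gamma\in\mathcal D_4$. (B2) For every $C\in\mathcal C$, the section $D\mapsto b_\kappa(C,D)$ is $\preceq$-monotone, i.e. $D_1\preceq D_2$ implies $b_\kappa(C,D_1)\le b_\kappa(C,D_2)$. (B3) $b_\kappa(M,M)=1$.
   Context: $\mathcal C$ is the set of all bivariate copulas, with the uniform topology; $\mu_C$ is the Borel probability measure on $[0,1]^2$ associated with $C\in\mathcal C$. $M(u,v)=\min(u,v)$. $C\preceq D$ means $C(u,v)\le D(u,v)$ for all $(u,v)\in[0,1]^2$. $\mathcal D_4$ is the (8-element) symmetry group of $[0,1]^2$ generated by $\pi(u,v)=(v,u)$ and $\sigma_1(u,v)=(1-u,v)$ under composition. For $\gamma\in\mathcal D_4$ and $C\in\mathcal C$, $C^\gamma$ is the copula with $\mu_{C^\gamma}=\gamma_\#\mu_C$, where $\gamma_\#\mu(A)=\mu(\gamma^{-1}(A))$. The map $\varepsilon:\mathcal D_4\to\{-1,1\}$ is the group homomorphism determined by $\varepsilon(\pi)=1$, $\varepsilon(\sigma_1)=-1$. A functional $\kappa:\mathcal C\to\mathbb R$ is a measure of concordance if: (A1) $\kappa(C^\pi)=\kappa(C)$ for every $C$; (A2) $C\preceq D$ implies $\kappa(C)\le\kappa(D)$;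 (A3) $\kappa(M)=1$; (A4) $\kappa(C^{\sigma_1})=-\kappa(C)$ for every $C$; (A5) $C_n\to C$ uniformly implies $\kappa(C_n)\to\kappa(C)$. $\kappa:\mathcal C\to\mathbb R$ has degree at most two if for every $C,D\in\mathcal C$ the map $t\mapsto\kappa((1-t)C+tD)$ agrees on $[0,1]$ with a real polynomial of degree at most two. The canonical polarization of $\kappa$ is $b_\kappa(C,D)=2\kappa\left(\frac{C+D}{2}\right)-\frac{\kappa(C)+\kappa(D)}{2}$, $C,D\in\mathcal C$. *)

(* Defs.v *)
From HB Require Import structures.
From mathcomp Require Import all_boot all_order all_algebra.
From mathcomp Require Import all_classical all_reals all_analysis.
From mathcomp Require Import measurable_realfun.

Set Implicit Arguments.
Unset Strict Implicit.
Unset Printing Implicit Defensive.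

Import Order.TTheory GRing.Theory Num.Theory.
Import numFieldNormedType.Exports.

Local Open Scope classical_set_scope.
Local Open Scope ring_scope.

Definition uI (R : realType) : Type := {i01 R}.

Definition uval (R : realType) (u : uI R) : R := u%:num.

HB.instance Definition _ (R : realType) := Choice.copy (uI R) {i01 R}.
HB.instance Definition _ (R : realType) := isPointed.Build (uI R) 0%:i01.

(* The Borel sigma-algebra of [0,1] is the trace of that of [R]; on
   [uI R * uI R] the library's product sigma-algebra is then the Borel one. *)
HB.instance Definition _ (R : realType) :=
  Measurable.copy (uI R) (g_sigma_algebra_preimageType (@uval R)).

Notation usq R := (uI R * uI R)%type.

Section UnitSquare.
Variable R : realType.
Implicit Types u v : uI R.

Definition u0 : uI R := 0%:i01.
Definition u1 : uI R := 1%:i01.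

Definition uflip u : uI R := (1 - u%:num)%:i01.

Definition lower_box u v : set (usq R) :=
  [set p | uval p.1 <= uval u /\ uval p.2 <= uval v].

Lemma uval_ge0 u : 0 <= uval u. Proof. by rewrite /uval. Qed.
Lemma uval_le1 u : uval u <= 1. Proof. by rewrite /uval. Qed.
Lemma uval_inj : injective (@uval R). Proof. by move=> u v /val_inj. Qed.
Lemma uval0 : uval u0 = 0. Proof. by []. Qed.
Lemma uval1 : uval u1 = 1. Proof. by []. Qed.
Lemma uval_flip u : uval (uflip u) = 1 - uval u. Proof. by []. Qed.
Lemma uflipK : involutive uflip.
Proof. by move=> u; apply: uval_inj; rewrite !uval_flip subKr. Qed.

Lemma measurable_uval : measurable_fun setT (@uval R).
Proof. by move=> _ B mB; exists B. Qed.

Lemma measurable_uIP d (T : measurableType d) (f : T -> uI R) :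
  measurable_fun setT (@uval R \o f) -> measurable_fun setT f.
Proof.
move=> mf _ A [B mB <-]; rewrite !setTI; have := mf measurableT _ mB.
by rewrite setTI.
Qed.

Lemma measurable_uflip : measurable_fun setT uflip.
Proof.
apply: measurable_uIP; rewrite (_ : _ \o _ = fun u => 1 - uval u)//.
by apply: measurable_funB => //; exact: measurable_uval.
Qed.

Lemma measurable_lower_box u v : measurable (lower_box u v).
Proof.
rewrite (_ : lower_box _ _ = (@uval R @^-1` `]-oo, uval u]) `*`
                             (@uval R @^-1` `]-oo, uval v])).
  by apply: measurableX; rewrite -[X in measurable X]setTI;
    apply: measurable_uval.
by apply/seteqP; split => p /=; rewrite !in_itv.
Qed.

End UnitSquare.
Arguments u0 {R}.
Arguments u1 {R}.

(* [(s, a, b)] stands for the map that first exchanges the coordinates if [s],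
   then replaces the first one by its complement to 1 if [a], and the second
   one if [b]. [D4_map_inj], [D4_mapM] and [D4_generatedP] identify [D4] with
   the group of maps generated by the exchange of the coordinates and
   (u, v) |-> (1 - u, v) under composition. *)
Definition D4 : Type := (bool * bool * bool)%type.

Section D4.
Variable R : realType.
Implicit Types g h : D4.

Definition D4_map g (p : usq R) : usq R :=
  let: (s, a, b) := g in
  let q := if s then (p.2, p.1) else p in
  (if a then uflip q.1 else q.1, if b then uflip q.2 else q.2).

Definition D4_pi : D4 := (true, false, false).
Definition D4_sigma1 : D4 := (false, true, false).

Definition D4_mul g h : D4 :=
  let: (s, a, b) := g in let: (t, c, d) := h in
  (s (+) t, a (+) (if s then d else c), b (+) (if s then c else d)).

(* The homomorphism determined by [D4_sign_pi], [D4_sign_sigma1], [D4_signM]. *)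
Definition D4_sign g : R := let: (s, a, b) := g in (-1) ^+ (a (+) b).

Lemma D4_map_pi (u v : uI R) : D4_map D4_pi (u, v) = (v, u).
Proof. by []. Qed.

Lemma D4_map_sigma1 (u v : uI R) :
  D4_map D4_sigma1 (u, v) = ((1 - u%:num)%:i01, v).
Proof. by []. Qed.

Lemma D4_mapM g h : D4_map (D4_mul g h) = D4_map g \o D4_map h.
Proof.
apply/funext => -[u v].
by case: g h => [[[] []] []] [[[] []] []]; rewrite /= ?uflipK.
Qed.

Lemma D4_map_inj : injective D4_map.
Proof.
have u10 : u1 <> u0 :> uI R.
  by move=> /(congr1 (@uval R)) /eqP; rewrite uval0 uval1 oner_eq0.
have f0 : uflip u0 = u1 :> uI R by apply: uval_inj; rewrite uval_flip subr0.
have f1 : uflip u1 = u0 :> uI R by apply: uval_inj; rewrite uval_flip subrr.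
move=> g h gh.
have := congr1 (@^~ (u0, u0)) gh; have := congr1 (@^~ (u0, u1)) gh.
by case: g h {gh} => [[[] []] []] [[[] []] []] //=; rewrite ?f0 ?f1;
  congruence.
Qed.

Inductive D4_generated : (usq R -> usq R) -> Prop :=
| D4_gen_pi : D4_generated (fun p => (p.2, p.1))
| D4_gen_sigma1 : D4_generated (fun p => (uflip p.1, p.2))
| D4_gen_comp f1 f2 :
    D4_generated f1 -> D4_generated f2 -> D4_generated (f1 \o f2).

Lemma D4_generatedP f : D4_generated f <-> exists g, f = D4_map g.
Proof.
split=> [|[g ->]].
  elim=> [||f1 f2 _ [g1 ->] _ [g2 ->]].
  - by exists D4_pi.
  - by exists D4_sigma1.
  - by exists (D4_mul g1 g2); rewrite D4_mapM.
pose gen h := D4_generated (D4_map h).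
have genM h1 h2 : gen h1 -> gen h2 -> gen (D4_mul h1 h2).
  by rewrite /gen D4_mapM; exact: D4_gen_comp.
have gpi : gen D4_pi by exact: D4_gen_pi.
have gs1 : gen D4_sigma1 by exact: D4_gen_sigma1.
have gid : gen (false, false, false) by exact: (genM _ _ gpi gpi).
have gs2 : gen (false, false, true).
  exact: (genM _ _ gpi (genM _ _ gs1 gpi)).
have gs a b : gen (false, a, b).
  by case: a b => [] []; [exact: (genM _ _ gs1 gs2)|exact: gs1|exact: gs2|].
case: g => [[[] a] b]; last exact: gs.
by have := genM _ _ (gs a b) gpi; rewrite /D4_mul /= !addbF.
Qed.

Lemma D4_sign_pi : D4_sign D4_pi = 1. Proof. by []. Qed.
Lemma D4_sign_sigma1 : D4_sign D4_sigma1 = -1. Proof. by []. Qed.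

Lemma D4_signM g h : D4_sign (D4_mul g h) = D4_sign g * D4_sign h.
Proof.
by case: g h => [[[] []] []] [[[] []] []];
  rewrite /= ?expr0 ?expr1 ?mulN1r ?mul1r ?opprK.
Qed.

Lemma measurable_D4_map g : measurable_fun setT (D4_map g).
Proof.
have m1 : measurable_fun setT (fst : usq R -> uI R) by exact: measurable_fst.
have m2 : measurable_fun setT (snd : usq R -> uI R) by exact: measurable_snd.
have mf (f : usq R -> uI R) : measurable_fun setT f ->
    measurable_fun setT (@uflip R \o f).
  by move=> ?; apply: measurableT_comp => //; exact: measurable_uflip.
case: g => [[s a] b].
have -> : D4_map (s, a, b) = fun p =>
    ((if a then @uflip R \o (if s then snd else fst)
      else (if s then snd else fst)) p,
     (if b then @uflip R \o (if s then fst else snd)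
      else (if s then fst else snd)) p).
  by apply/funext => p; rewrite /D4_map; case: s a b => [] [] [].
by apply: measurable_fun_pair; case: s a b => [] [] [] //; exact: mf.
Qed.

HB.instance Definition _ g :=
  isMeasurableFun.Build _ _ (usq R) (usq R) (D4_map g) (measurable_D4_map g).

End D4.

(* A bivariate copula is the restriction to the unit square of the joint
   distribution function of a Borel probability measure with uniform margins;
   that measure is unique, see [cop_measure_unique]. *)
Section Copula.
Variable R : realType.
Local Notation usq := (usq R).
Implicit Types u v : uI R.

Record copula : Type := Copula {
  cop :> usq -> R;
  cop_df : exists mu : probability usq R,
      forall u v, mu (lower_box u v) = (cop (u, v))%:E;
  cop_margin1 : forall u, cop (u, u1) = uval u;
  cop_margin2 : forall v, cop (u1, v) = uval v }.

Implicit Types C D : copula.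

Lemma copula_eqP C D : (C : usq -> R) =1 D -> C = D.
Proof.
case: C D => [c c1 c2 c3] [d d1 d2 d3] /= /funext cd.
by move: c1 c2 c3; rewrite cd => *; congr Copula; exact: Prop_irrelevance.
Qed.

Definition cop_measure C : probability usq R := sval (cid (cop_df C)).

Lemma cop_measureE C u v : cop_measure C (lower_box u v) = (C (u, v))%:E.
Proof. by rewrite /cop_measure; case: cid. Qed.

Lemma measurable_usqE :
  measurable = <<s range (fun p : usq => lower_box p.1 p.2) >>.
Proof.
set G := range _; apply/seteqP; split; last first.
  apply: smallest_sub; first exact: sigma_algebra_measurable.
  by move=> _ [p _ <-]; exact: measurable_lower_box.
pose T := g_sigma_algebraType G.
have mT u v : measurable (lower_box u v : set T).
  by apply: sub_sigma_algebra; exists (u, v).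
have hR (f : T -> R) : (forall p, 0 <= f p <= 1) ->
    (forall u, measurable [set p : T | f p <= uval u]) -> measurable_fun setT f.
  move=> f01 mf; apply: (measurability _ (RGenOInfty.measurableE R)).
  move=> _ [_ [x ->] <-]; rewrite setTI.
  rewrite (_ : _ @^-1` _ = ~` [set p | f p <= x]); last first.
    by apply/seteqP; split => p /=; rewrite in_itv/= andbT ltNge => /negP.
  apply: measurableC; have [x0|x0] := ltP x 0.
    rewrite (_ : [set _ | _] = set0)//; apply/seteqP; split => // p /=.
    by case/andP: (f01 p) => f0 _ fx; move: (le_lt_trans (le_trans f0 fx) x0);
      rewrite ltxx.
  have [x1|x1] := leP x 1; first exact: (mf (Itv01 x0 x1)).
  rewrite (_ : [set _ | _] = setT)//; apply/seteqP; split => // p _ /=.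
  by apply: le_trans (ltW x1); case/andP: (f01 p).
have m1 : measurable_fun setT (fst : T -> uI R).
  apply: measurable_uIP; apply: hR => [p|u].
    by apply/andP; split; [exact: uval_ge0|exact: uval_le1].
  rewrite (_ : [set _ | _] = lower_box u u1)//.
  by apply/seteqP; split => p /= => [pu|[]//]; split => //; exact: uval_le1.
have m2 : measurable_fun setT (snd : T -> uI R).
  apply: measurable_uIP; apply: hR => [p|u].
    by apply/andP; split; [exact: uval_ge0|exact: uval_le1].
  rewrite (_ : [set _ | _] = lower_box u1 u)//.
  by apply/seteqP; split => p /= => [pu|[]//]; split => //; exact: uval_le1.
have mid : measurable_fun setT (fun p : T => (p.1, p.2) : usq).
  exact: measurable_fun_pair.
move=> A mA; have := mid measurableT _ mA.
by rewrite setTI (_ : _ @^-1` A = A)//; apply/seteqP; split => -[].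
Qed.

Lemma cop_measure_unique C (mu : probability usq R) :
  (forall u v, mu (lower_box u v) = (C (u, v))%:E) ->
  forall A, measurable A -> cop_measure C A = mu A.
Proof.
move=> muC; apply: (@measure_unique _ _ _
  (range (fun p : usq => lower_box p.1 p.2)) (fun=> setT)).
- exact: measurable_usqE.
- move=> _ _ [[a b] _ <-] [[c d] _ <-].
  pose m (x y : uI R) := if uval x <= uval y then x else y.
  have mE z x y : (z <= uval (m x y)) = (z <= uval x) && (z <= uval y).
    by rewrite -le_min /m minElt; case: ltgtP => // ->.
  exists (m a c, m b d) => //; apply/seteqP; split => p /=;
    rewrite /lower_box/= !mE.
    by move=> [/andP[-> ->] /andP[-> ->]].
  by move=> [[-> ->] [-> ->]].
- move=> _; exists (u1, u1) => //; apply/seteqP; split => // p _ /=.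
  by split; exact: uval_le1.
- by rewrite bigcup_const//; exists 0%N.
- by move=> _ [[u v] _ <-] /=; rewrite muC cop_measureE.
- by move=> _; rewrite (le_lt_trans (probability_le1 _ _))// ltry.
Qed.

Lemma margin_lt (mu : probability usq R) (X : usq -> uI R) :
  measurable_fun setT X ->
  (forall u, mu [set p | uval (X p) <= uval u] = (uval u)%:E) ->
  forall u, mu [set p | uval (X p) < uval u] = (uval u)%:E.
Proof.
move=> mX muX u.
have mR : measurable_fun setT (fun p => uval (X p)).
  by apply: measurableT_comp mX; exact: measurable_uval.
have mlt : measurable [set p | uval (X p) < uval u].
  rewrite [X in measurable X](_ : _ =
      (fun p => uval (X p)) @^-1` `]-oo, uval u[).
    by rewrite -[X in measurable X]setTI; exact: mR.
  by apply/seteqP; split => p /=; rewrite in_itv.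
have mle v : measurable [set p | uval (X p) <= uval v].
  rewrite [X in measurable X](_ : _ =
      (fun p => uval (X p)) @^-1` `]-oo, uval v]).
    by rewrite -[X in measurable X]setTI; exact: mR.
  by apply/seteqP; split => p /=; rewrite in_itv.
apply/eqP; rewrite eq_le; apply/andP; split.
  by rewrite -muX le_measure ?inE// => p /= /ltW.
apply/lee_addgt0Pr => e e0; have [ue|eu] := ltP (uval u) e.
  by rewrite (@le_trans _ _ e%:E) ?lee_fin ?(ltW ue)// leeDr.
have b0 : 0 <= uval u - e by rewrite subr_ge0.
have b1 : uval u - e <= 1.
  by rewrite lerBlDr (le_trans (uval_le1 u))// lerDl ltW.
rewrite -leeBlDr// -EFinB -[leLHS]/((uval (Itv01 b0 b1 : uI R))%:E) -muX.
apply: le_measure; rewrite ?inE// => p /= /le_lt_trans; apply.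
by rewrite /uval/= ltrBlDr ltrDl.
Qed.

Lemma margin_flip (mu : probability usq R) (X : usq -> uI R) :
  measurable_fun setT X ->
  (forall u, mu [set p | uval (X p) <= uval u] = (uval u)%:E) ->
  forall u, mu [set p | uval (uflip (X p)) <= uval u] = (uval u)%:E.
Proof.
move=> mX muX u.
have := margin_lt mX muX (uflip u).
have fE (w v : uI R) : (uval (uflip w) <= uval v) = (uval (uflip v) <= uval w).
  by rewrite !uval_flip lerBlDl -lerBlDr.
rewrite (_ : [set p | uval (uflip (X p)) <= _] =
  ~` [set p | uval (X p) < uval (uflip u)]); last first.
  apply/seteqP; split => p.
    by rewrite /setC /mkset fE leNgt => /negP.
  by rewrite /setC /mkset fE leNgt => /negP.
move=> e; rewrite probability_setC ?e.
  by rewrite -EFinB uval_flip subKr.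
rewrite [X in measurable X](_ : _ =
  (fun p => uval (X p)) @^-1` `]-oo, uval (uflip u)[).
  rewrite -[X in measurable X]setTI.
  by apply: (measurableT_comp (@measurable_uval R) mX).
by apply/seteqP; split => p /=; rewrite in_itv.
Qed.

Lemma cop_measure_fst C u :
  cop_measure C [set p | uval p.1 <= uval u] = (uval u)%:E.
Proof.
rewrite -[X in X%:E](cop_margin1 C) -cop_measureE; congr (cop_measure C _).
by apply/seteqP; split => p /= => [pu|[]//]; split => //; exact: uval_le1.
Qed.

Lemma cop_measure_snd C v :
  cop_measure C [set p | uval p.2 <= uval v] = (uval v)%:E.
Proof.
rewrite -[X in X%:E](cop_margin2 C) -cop_measureE; congr (cop_measure C _).
by apply/seteqP; split => p /= => [pu|[]//]; split => //; exact: uval_le1.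
Qed.

Section copula_of.
Variables (mu : probability usq R) (c : usq -> R).
Hypothesis muc : forall u v, mu (lower_box u v) = (c (u, v))%:E.
Hypothesis mu1 : forall u, mu [set p | uval p.1 <= uval u] = (uval u)%:E.
Hypothesis mu2 : forall v, mu [set p | uval p.2 <= uval v] = (uval v)%:E.

Let c1 u : c (u, u1) = uval u.
Proof.
apply/EFin_inj; rewrite -muc -mu1; congr (mu _).
by apply/seteqP; split => p /= => [[]//|pu]; split => //; exact: uval_le1.
Qed.

Let c2 v : c (u1, v) = uval v.
Proof.
apply/EFin_inj; rewrite -muc -mu2; congr (mu _).
by apply/seteqP; split => p /= => [[]//|pu]; split => //; exact: uval_le1.
Qed.

Definition copula_of : copula :=
  Copula (ex_intro _ mu muc) c1 c2.

End copula_of.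

Section Action.
Variables (C : copula) (g : D4).

Let mu : probability usq R :=
  distribution (cop_measure C) (D4_map g : {mfun usq >-> usq}).

Let muc u v :
  mu (lower_box u v) =
  (fine (pushforward (cop_measure C) (D4_map g)
           (lower_box (u, v).1 (u, v).2)))%:E.
Proof.
rewrite fineK//.
exact: (fin_num_measure mu (lower_box u v) (measurable_lower_box u v)).
Qed.

Let mu1 u : mu [set p | uval p.1 <= uval u] = (uval u)%:E.
Proof.
rewrite /mu /distribution /pushforward /D4_map.
case: g => [[[] []] b] /=; rewrite /preimage/=.
- exact: (margin_flip measurable_snd (cop_measure_snd C)).
- exact: cop_measure_snd.
- exact: (margin_flip measurable_fst (cop_measure_fst C)).
- exact: cop_measure_fst.
Qed.

Let mu2 v : mu [set p | uval p.2 <= uval v] = (uval v)%:E.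
Proof.
rewrite /mu /distribution /pushforward /D4_map.
case: g => [[[] a] []] /=; rewrite /preimage/=.
- exact: (margin_flip measurable_fst (cop_measure_fst C)).
- exact: cop_measure_fst.
- exact: (margin_flip measurable_snd (cop_measure_snd C)).
- exact: cop_measure_snd.
Qed.

(* Characterised by its measure, see [cop_measure_act]. *)
Definition cop_act : copula := copula_of
  (c := fun p =>
     fine (pushforward (cop_measure C) (D4_map g) (lower_box p.1 p.2)))
  muc mu1 mu2.

Lemma cop_measure_act (A : set usq) : measurable A ->
  cop_measure cop_act A = pushforward (cop_measure C) (D4_map g) A.
Proof. exact: (cop_measure_unique (C := cop_act) muc). Qed.

End Action.

Let uclamp01 (x : R) : 0 <= Num.max 0 (Num.min x 1) <= 1.
Proof. by rewrite le_max lexx ge_max ler01 ge_min lexx orbT. Qed.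

Definition uclamp (x : R) : uI R :=
  Itv01 (proj1 (andP (uclamp01 x))) (proj2 (andP (uclamp01 x))).

Definition diag (x : measurableTypeR R) : usq := (uclamp x, uclamp x).

Lemma measurable_diag : measurable_fun setT diag.
Proof.
suff ? : measurable_fun setT (uclamp : measurableTypeR R -> uI R).
  by exact: measurable_fun_pair.
apply: (@measurable_uIP _ _ (measurableTypeR R)).
rewrite (_ : _ \o _ = fun x => Num.max 0 (Num.min x 1))//.
by apply: measurable_maxr => //; exact: measurable_minr.
Qed.

HB.instance Definition _ :=
  isMeasurableFun.Build _ _ _ _ diag measurable_diag.

Let muM : probability usq R :=
  distribution (uniform_prob (@ltr01 R)) (diag : {mfun _ >-> usq}).

Lemma uniform_uclamp u :
  uniform_prob (@ltr01 R) [set x | uval (uclamp x) <= uval u] = (uval u)%:E.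
Proof.
rewrite /uniform_prob integral_uniform_pdf.
rewrite (_ : _ `&` _ = `[0, uval u]%classic); last first.
  apply/seteqP; split => x /=; rewrite !in_itv/= /uval/= ge_max.
    move=> [/andP[_ xu] /andP[x0 x1]]; rewrite x0.
    by move: xu; rewrite ge_min => /orP[//|/(le_trans x1)].
  move=> /andP[x0 xu]; rewrite x0 uval_ge0 ge_min xu; split => //=.
  exact: le_trans xu (uval_le1 u).
rewrite (eq_integral (cst 1%E)).
  by rewrite integral_cst//= lebesgue_measure_itv/= lte_fin mul1e;
    case: ltgtP (uval_ge0 u) => // [_|<-] _;
    rewrite ?oppr0 ?adde0 ?EFinN ?sube0.
move=> x; rewrite inE/= in_itv/= => /andP[x0 xu].
by rewrite /uniform_pdf x0 (le_trans xu (uval_le1 u)) subr0 invr1.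
Qed.

Let muMc u v :
  muM (lower_box u v) = (Num.min (uval (u, v).1) (uval (u, v).2))%:E.
Proof.
rewrite /muM /distribution /pushforward /= /preimage /lower_box /=.
have [uv|vu] := leP (uval u) (uval v).
  rewrite -uniform_uclamp; congr (uniform_prob _ _).
  by apply/seteqP; split => x /= => [[]//|xu]; split => //; exact: le_trans uv.
rewrite -[in RHS]uniform_uclamp; congr (uniform_prob _ _).
apply/seteqP; split => x /= => [[]//|xv]; split => //.
exact: le_trans (ltW vu).
Qed.

Let muM1 u : muM [set p | uval p.1 <= uval u] = (uval u)%:E.
Proof. exact: uniform_uclamp. Qed.

Let muM2 v : muM [set p | uval p.2 <= uval v] = (uval v)%:E.
Proof. exact: uniform_uclamp. Qed.

Definition cop_M : copula :=
  copula_of (c := fun p => Num.min (uval p.1) (uval p.2)) muMc muM1 muM2.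

Section Mix.
Variables (t : {i01 R}) (C D : copula).

Definition mix_measure : set usq -> \bar R :=
  measure_add (mscale (1 - t%:num)%:nng (cop_measure C))
              (mscale t%:num%:nng (cop_measure D)).

HB.instance Definition _ := Measure.on mix_measure.

Let mix_measureE A : mix_measure A =
  ((1 - t%:num)%:E * cop_measure C A + t%:num%:E * cop_measure D A)%E.
Proof. by rewrite /mix_measure measure_addE. Qed.

Let mix_measure_setT : mix_measure setT = 1%E.
Proof.
by rewrite mix_measureE !probability_setT !mule1 -EFinD subrK.
Qed.

HB.instance Definition _ :=
  Measure_isProbability.Build _ _ _ mix_measure mix_measure_setT.

Let mixc u v : mix_measure (lower_box u v) =
  ((1 - t%:num) * C (u, v) + t%:num * D (u, v))%:E.
Proof. by rewrite mix_measureE !cop_measureE. Qed.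

Let mix1 u : mix_measure [set p | uval p.1 <= uval u] = (uval u)%:E.
Proof.
by rewrite mix_measureE !cop_measure_fst -!EFinM -EFinD -mulrDl subrK mul1r.
Qed.

Let mix2 v : mix_measure [set p | uval p.2 <= uval v] = (uval v)%:E.
Proof.
by rewrite mix_measureE !cop_measure_snd -!EFinM -EFinD -mulrDl subrK mul1r.
Qed.

Definition cop_mix : copula :=
  copula_of (mu := mix_measure)
    (c := fun p => (1 - t%:num) * C p + t%:num * D p) mixc mix1 mix2.

End Mix.

Let half_ge0 : 0 <= 2^-1 :> R. Proof. by rewrite invr_ge0. Qed.
Let half_le1 : 2^-1 <= 1 :> R. Proof. by rewrite invf_le1// ler1n. Qed.

Definition cop_mid C D : copula := cop_mix (Itv01 half_ge0 half_le1) C D.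

Lemma cop_midE C D p : cop_mid C D p = (C p + D p) / 2.
Proof.
have h : 1 - 2^-1 = 2^-1 :> R by rewrite {1}(splitr 1) div1r addrK.
by rewrite /= h -mulrDr mulrC.
Qed.

Definition cop_le C D : Prop := forall p, C p <= D p.

HB.instance Definition _ := gen_eqMixin copula.
HB.instance Definition _ := gen_choiceMixin copula.

HB.instance Definition _ := Topological.copy copula
  (initial_topology (cop : copula -> {uniform usq -> R})).

Implicit Types kappa : copula -> R.

Record is_measure_of_concordance kappa : Prop := {
  moc_sym : forall C, kappa (cop_act C D4_pi) = kappa C;
  moc_mono : forall C D, cop_le C D -> kappa C <= kappa D;
  moc_M : kappa cop_M = 1;
  moc_sigma1 : forall C, kappa (cop_act C D4_sigma1) = - kappa C;
  moc_cvg : forall (Cn : nat -> copula) C,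
    {uniform, (fun n => Cn n : usq -> R) @ \oo --> (C : usq -> R)} ->
    kappa (Cn n) @[n --> \oo] --> kappa C }.

Definition degree_le2 kappa : Prop := forall C D, exists p : {poly R},
  (size p <= 3)%N /\ forall t : {i01 R}, kappa (cop_mix t C D) = p.[t%:num].

Definition polarization kappa C D : R :=
  2 * kappa (cop_mid C D) - (kappa C + kappa D) / 2.

End Copula.

(* Main.v *)
(* As [b(C, C) = kappa(C)], interpolation at 0, 1/2 and 1 gives
   [kappa((1-t)C + tD) = (1-t)^2 kappa(C) + 2t(1-t) b(C, D) + t^2 kappa(D)].
   If [kappa] is monotone and [D1] is below [D2], comparing these expansions to
   first order at [t = 0] yields [b(C, D1) <= b(C, D2)]; conversely, when the
   sections of the symmetric map [b] are monotone,
   [b(C, C) <= b(C, D) = b(D, C) <= b(D, D)] whenever [C] is below [D].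
   The symmetries pass from [kappa] to [b] because [D4] acts by affine maps. *)
Require Import Defs.
From mathcomp Require Import all_boot all_order all_algebra.
From mathcomp Require Import all_classical all_reals all_analysis.
From mathcomp Require Import ring lra.

Import Order.TTheory GRing.Theory Num.Theory.
Import numFieldNormedType.Exports.

Local Open Scope classical_set_scope.
Local Open Scope ring_scope.

(** Pushing forward by [g] and then by [h] is pushing forward by [h \o g], hence the reversed order
    in [D4_mul h g]. *)
Lemma cop_act_comp (R : realType) (C : copula R) (g h : D4) :
  cop_act (cop_act C g) h = cop_act C (D4_mul h g).
Proof.
apply: copula_eqP => p; congr fine.
rewrite /pushforward cop_measure_act ?D4_mapM//.
rewrite -[X in measurable X]setTI.
by apply: measurable_D4_map => //; exact: measurable_lower_box.
Qed.

(** [cop_measure] is obtained by choice, so it is identified with [mix_measure] only through the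
    uniqueness of the measure of a copula. *)
Lemma cop_measure_mix (R : realType) (t : {i01 R}) (C D : copula R) A :
  measurable A -> cop_measure (cop_mix t C D) A =
  ((1 - t%:num)%:E * cop_measure C A + t%:num%:E * cop_measure D A)%E.
Proof.
move=> mA.
have mixE B : mix_measure t C D B =
    ((1 - t%:num)%:E * cop_measure C B + t%:num%:E * cop_measure D B)%E.
  exact: measure_addE.
rewrite (@cop_measure_unique _ (cop_mix t C D) (mix_measure t C D)) //.
  exact: mixE.
by move=> u v; rewrite [LHS]mixE !cop_measureE.
Qed.

Lemma cop_act_mix (R : realType) (t : {i01 R}) (C D : copula R) (g : D4) :
  cop_act (cop_mix t C D) g = cop_mix t (cop_act C g) (cop_act D g).
Proof.
apply: copula_eqP => p /=; rewrite /pushforward.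
set A := _ @^-1` _.
have mA : measurable A.
  rewrite -[X in measurable X]setTI.
  by apply: measurable_D4_map => //; exact: measurable_lower_box.
(* Preimages commute with mixing; finiteness of the measures lets [fine] pass through the sum and
   the products. *)
rewrite cop_measure_mix// fineD ?fineM//= ?fin_numM// fin_num_measure//.
Qed.

Lemma cop_mix_le (R : realType) (t : {i01 R}) (C D1 D2 : copula R) :
  cop_le D1 D2 -> cop_le (cop_mix t C D1) (cop_mix t C D2).
Proof. by move=> D12 p; rewrite /= lerD2l ler_wpM2l. Qed.

Lemma polarizationC (R : realType) (kappa : copula R -> R) (C D : copula R) :
  polarization kappa C D = polarization kappa D C.
Proof.
rewrite /polarization (_ : cop_mid C D = cop_mid D C) 1?[kappa C + _]addrC//.
by apply: copula_eqP => p; rewrite !cop_midE addrC.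
Qed.

Lemma polarization_diag (R : realType) (kappa : copula R -> R)
    (C : copula R) : polarization kappa C C = kappa C.
Proof.
rewrite /polarization (_ : cop_mid C C = C); first by field.
by apply: copula_eqP => p; rewrite cop_midE; field.
Qed.

Lemma degree_le2_mixE (R : realType) (kappa : copula R -> R) :
  degree_le2 kappa -> forall (t : {i01 R}) (C D : copula R),
  kappa (cop_mix t C D) = (1 - t%:num) ^+ 2 * kappa C
    + 2 * t%:num * (1 - t%:num) * polarization kappa C D
    + t%:num ^+ 2 * kappa D.
Proof.
move=> kappa2 t C D; have [p [p3 pE]] := kappa2 C D.
rewrite /polarization /cop_mid !pE.
(* With three coefficients, the claim becomes a polynomial identity once [kappa C] and [kappa D] are
   read off at 0 and 1. *)
have hp x : p.[x] = p`_0 + p`_1 * x + p`_2 * x ^+ 2.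
  by rewrite (horner_coef_wide _ p3) !big_ord_recr big_ord0/= add0r mulr1.
have -> : kappa C = p.[0].
  rewrite -(pE 0%:i01); congr kappa.
  by apply: copula_eqP => q /=; rewrite subr0 mul0r mul1r addr0.
have -> : kappa D = p.[1].
  rewrite -(pE 1%:i01); congr kappa.
  by apply: copula_eqP => q /=; rewrite subrr mul0r mul1r add0r.
by rewrite !hp /=; field.
Qed.

Lemma polarization_le (R : realType) (kappa : copula R -> R) :
  degree_le2 kappa ->
  (forall C D, cop_le C D -> kappa C <= kappa D) ->
  forall C D1 D2 : copula R, cop_le D1 D2 ->
  polarization kappa C D1 <= polarization kappa C D2.
Proof.
move=> kappa2 kappa_le C D1 D2 D12; rewrite leNgt; apply/negP => b12.
set d := polarization kappa C D1 - polarization kappa C D2.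
have d0 : 0 < d by rewrite subr_gt0.
have e0 : 0 <= kappa D2 - kappa D1 by rewrite subr_ge0 kappa_le.
set e := kappa D2 - kappa D1 in e0.
(* At [t = d / (2 d + e)] the first order term [2 t (1 - t) d] exceeds the
   second order one [t ^ 2 e]. *)
have s0 : 0 < 2 * d + e by lra.
have t0 : 0 < d / (2 * d + e) by rewrite divr_gt0.
have t1 : d / (2 * d + e) <= 1 by rewrite ler_pdivrMr// mul1r; lra.
have := kappa_le _ _ (cop_mix_le _ (Itv01 (ltW t0) t1) C D1 D2 D12).
rewrite !(degree_le2_mixE _ _ kappa2) /=.
set t := d / _ in t0 t1 *.
have ts : t * (2 * d + e) = d by rewrite /t divfK// gt_eqF.
rewrite leNgt => /negP; apply; rewrite -subr_gt0.
(* The [kappa C] terms cancel; by the choice of [t] the remaining factor is [2 * d - d], so the gap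
   is [t * d > 0]. *)
rewrite [ltRHS](_ : _ = t * (2 * d - t * (2 * d + e))); last first.
  by rewrite /d /e; ring.
by rewrite ts mulr_gt0//; lra.
Qed.

(** The hypotheses give the rule on the two generators, and both the action and the sign respect
    products. *)
Lemma kappa_act_sign (R : realType) (kappa : copula R -> R) :
  (forall C, kappa (cop_act C D4_pi) = kappa C) ->
  (forall C, kappa (cop_act C D4_sigma1) = - kappa C) ->
  forall (g : D4) (C : copula R),
  kappa (cop_act C g) = D4_sign R g * kappa C.
Proof.
move=> kappa_pi kappa_sigma1 g.
have : D4_generated (D4_map (R := R) g) by apply/D4_generatedP; exists g.
(* The induction runs over generated maps; injectivity of [D4_map] then recovers the group
   element. *)
move fE : (D4_map _) => f gen_f; elim: gen_f g fE => {f}.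
- by move=> g /(D4_map_inj (R := R) (x2 := D4_pi)) -> C; rewrite kappa_pi mul1r.
- move=> g /(D4_map_inj (R := R) (x2 := D4_sigma1)) -> C.
  by rewrite kappa_sigma1 D4_sign_sigma1 mulN1r.
move=> f1 f2 gen_f1 IH1 gen_f2 IH2 g.
have /D4_generatedP[g1 f1E] := gen_f1; have /D4_generatedP[g2 f2E] := gen_f2.
rewrite f1E f2E -D4_mapM => /D4_map_inj -> C.
by rewrite -cop_act_comp IH1// IH2// D4_signM mulrA.
Qed.

Lemma polarization_act (R : realType) (kappa : copula R -> R) (g : D4) :
  (forall C, kappa (cop_act C g) = D4_sign R g * kappa C) ->
  forall C D : copula R, polarization kappa (cop_act C g) (cop_act D g) =
  D4_sign R g * polarization kappa C D.
Proof.
by move=> kg C D; rewrite /polarization /cop_mid -cop_act_mix !kg; ring.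
Qed.

(** In the initial topology, a neighbourhood of [C] contains the preimage of a uniformly open set
    around [C]. *)
Lemma cvg_copula (R : realType) (Cn : nat -> copula R) (C : copula R) :
  {uniform, (fun n => Cn n : usq R -> R) @ \oo --> (C : usq R -> R)} ->
  Cn n @[n --> \oo] --> C.
Proof. move=> CnC A [_ [[B oB <-] BC /filterS]]; apply.
by apply: (CnC B); apply: open_nbhs_nbhs; split. Qed.

Theorem proposition3p4 (R : realType) (kappa : copula R -> R)
    (kappa_continuous : continuous kappa)
    (kappa_degree : degree_le2 kappa) :
  is_measure_of_concordance kappa <->
  [/\ (forall (C D : copula R) (g : D4),
         polarization kappa (cop_act C g) (cop_act D g)
         = D4_sign R g * polarization kappa C D),
      (forall C D1 D2 : copula R, cop_le D1 D2 ->
         polarization kappa C D1 <= polarization kappa C D2)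
    & polarization kappa (cop_M R) (cop_M R) = 1].
Proof.
split=> [[kappa_pi kappa_le kappa_M kappa_sigma1 _]|[b_act b_le b_M]].
  split; last by rewrite polarization_diag.
    by move=> C D g; apply/polarization_act/kappa_act_sign.
  exact: polarization_le.
(* (B1) restricted to the diagonal, where [b] is [kappa], gives (A1) and (A4) together. *)
have kappa_act g C : kappa (cop_act C g) = D4_sign R g * kappa C.
  by rewrite -!(polarization_diag _ kappa) b_act.
split.
- by move=> C; rewrite kappa_act mul1r.
- move=> C D CD; rewrite -(polarization_diag _ kappa C).
  rewrite -(polarization_diag _ kappa D) (le_trans (b_le _ _ _ CD))//.
  by rewrite polarizationC b_le.
- by rewrite -(polarization_diag _ kappa) b_M.
- by move=> C; rewrite kappa_act D4_sign_sigma1 mulN1r.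
- move=> Cn C /cvg_copula CnC; apply: continuous_cvg => //.
  exact: kappa_continuous.
Qed.
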